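(* Let $X=\Gamma\backslash G$ be a complex parallelisable nilmanifold, let $\mathfrak g$ be the complex Lie algebra of $G$, and suppose $\mathfrak g$ is $\nu$-step nilpotent. Let $\Phi=\sum_{k\ge 1}\Phi_k$ be the recursively defined series with $\Phi_1(\underline t)=\sum_{i,j}t_i^j\,\bar\omega^i\otimes X_j$ described in the context. Then the obstruction map is $$\mathrm{obs}(\underline t)=\sum_{\substack{1\le i,j<\nu\\ i+j\le \nu}}H[\Phi_i(\underline t),\Phi_j(\underline t)].$$ In particular, $\mathrm{Kur}(X)$ is cut out (in a small ball around $0$ in $\mathcal H^1\otimes\mathfrak g$) by polynomial equations of degree at most $\nu$.
   Context: Setting: $G$ is a simply connected complex nilpotent Lie group with Lie algebra $\mathfrak g$, $\Gamma\subset G$ a lattice (discrete cocompact subgroup), and $X=\Gamma\backslash G$ the resulting compact complex manifold, called a complex parallelisable nilmanifold. The descending central series is $\mathcal C_0\mathfrak g=\mathfrak g$, $\mathcal C_{k+1}\mathfrak g=[\mathcal C_k\mathfrak g,\mathfrak g]$; $\mathfrak g$ is $\nu$-step nilpotent if $\nu$ is the smallest integer with $\mathcal C_\nu\mathfrak g=0$. The complexification of the real Lie algebra underlying $\mathfrak g$ is $\mathfrak g_{\mathbb C}=\mathfrak g\oplus\bar{\mathfrak g}$ with $[\bar x,\bar y]=\overline{[x,y]}$ and $[\mathfrak g,\bar{\mathfrak g}]=0$; here $\mathfrak g$ is the space of left-invariant vectors of type $(1,0)$ and $\bar{\mathfrak g}$ those of type $(0,1)$. Let $\bar\partial:\bar{\mathfrak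 g}^*\to\Lambda^2\bar{\mathfrak g}^*$ be $(\bar\partial\bar\alpha)(\bar x,\bar y)=-\bar\alpha([\bar x,\bar y])$, extended as a derivation to $\Lambda^*\bar{\mathfrak g}^*$, and extended to $\Lambda^*\bar{\mathfrak g}^*\otimes\mathfrak g$ by $\bar\partial(\bar\alpha\otimes X)=(\bar\partial\bar\alpha)\otimes X$. The bracket $(\bar{\mathfrak g}^*\otimes\mathfrak g)\times(\bar{\mathfrak g}^*\otimes\mathfrak g)\to\Lambda^2\bar{\mathfrak g}^*\otimes\mathfrak g$ is the Schouten bracket, which in this setting is bilinear with $[\bar\alpha\otimes X,\bar\beta\otimes Y]=\bar\alpha\wedge\bar\beta\otimes[X,Y]$. Fix a hermitian inner product on $\mathfrak g$, with induced inner products on $\Lambda^k\bar{\mathfrak g}^*$; let $\bar\partial^*$ be the adjoint of $\bar\partial$, $\Delta=\bar\partial\bar\partial^*+\bar\partial^*\bar\partial$, $\mathcal H^k=\ker(\Delta|_{\Lambda^k\bar{\mathfrak g}^*})$, $B^k=\bar\partial(\Lambda^{k-1}\bar{\mathfrak g}^* )$, $V^k=\bar\partial^*(\Lambda^{k+1}\bar{\mathfrak g}^* )$, so that $\Lambda^k\bar{\mathfrak g}^*=B^k\oplus\mathcal H^k\oplus V^k$ orthogonally. One has $B^1=0$, $\mathcal H^1=\ker(\bar\partial|_{\bar{\mathfrak g}^*})=\overline{\mathrm{Ann}([\mathfrak g,\mathfrak g])}$, and $H^1(X,\Theta_X)\cong\mathcal H^1\otimes\mathfrak g$, where $\Theta_X$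 is the holomorphic tangent sheaf. Let $P$ and $H$ be the orthogonal projections of $\Lambda^2\bar{\mathfrak g}^*\otimes\mathfrak g$ onto $B^2\otimes\mathfrak g$ and $\mathcal H^2\otimes\mathfrak g$, and let $\delta:B^2\otimes\mathfrak g\to V^1\otimes\mathfrak g$ be the inverse of the isomorphism $\bar\partial:V^1\otimes\mathfrak g\to B^2\otimes\mathfrak g$. Let $X_1,\dots,X_n$ be a basis of $\mathfrak g$ and $\bar\omega^1,\dots,\bar\omega^m$ a basis of $\mathcal H^1$. For $\mu=\sum_{i,j}t_i^j\,\bar\omega^i\otimes X_j\in\mathcal H^1\otimes\mathfrak g$ set $\Phi_1(\underline t)=\mu$, $\Phi_k(\underline t)=-\delta P\sum_{1\le i<k}[\Phi_i(\underline t),\Phi_{k-i}(\underline t)]$ for $k\ge2$, and $\Phi(\underline t)=\sum_{k\ge1}\Phi_k(\underline t)$ (convergent for small $\underline t$). The obstruction map is $\mathrm{obs}:\mathcal H^1\otimes\mathfrak g\to\mathcal H^2\otimes\mathfrak g$, $\mu\mapsto H[\Phi(\underline t),\Phi(\underline t)]$. The Kuranishi space is the complex analytic space $\mathrm{Kur}(X)=\{\mu\in\mathcal H^1\otimes\mathfrak g: \|\mu\|<\epsilon,\ \mathrm{obs}(\mu)=0\}$ for small $\epsilon>0$, with the structure defined by the components of $\mathrm{obs}$. *)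

(* Defs.v *)
From HB Require Import structures.
From mathcomp Require Import all_boot all_order all_algebra.
From mathcomp Require Import complex.
From mathcomp Require Import all_classical all_reals topology normedtype sequences derive.
From mathcomp Require mpoly.

Set Implicit Arguments.
Unset Strict Implicit.
Unset Printing Implicit Defensive.

Import Order.TTheory GRing.Theory Num.Theory.
Import numFieldNormedType.Exports.

Local Open Scope classical_set_scope.
Local Open Scope ring_scope.

(* MathComp-Analysis gives a topology to abstract numeric fields only; this
   transfers the one defined by the modulus to the concrete type R[i]. *)
#[warning="-redundant-canonical-projection"]
HB.instance Definition _ (R : realType) := PseudoMetricNormedZmod.copy R[i] (R[i])^o.

(** * Complex Lie algebras on [C^n], lower central series *)

Record lie_algebra (R : realType) (n : nat) := LieAlgebra {
  lie :> 'rV[R[i]]_n -> 'rV[R[i]]_n -> 'rV[R[i]]_n;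
  lie_linearl : forall y, linear (lie^~ y);
  lie_linearr : forall x, linear (lie x);
  lie_alt : forall x, lie x x = 0;
  lie_jacobi : forall x y z,
    lie x (lie y z) + lie y (lie z x) + lie z (lie x y) = 0 }.

(* By bilinearity, brackets of basis vectors span [C_k g, g]. *)
Fixpoint lower_central (R : realType) (n : nat) (L : lie_algebra R n) (k : nat) :
    {vspace 'rV[R[i]]_n} :=
  if k is k'.+1 then
    <<[seq L x y | x <- vbasis (lower_central L k'), y <- vbasis fullv]>>%VS
  else fullv.

Definition nilpotent_step (R : realType) (n : nat) (L : lie_algebra R n) (nu : nat) :=
  lower_central L nu = 0%VS /\ forall k, lower_central L k = 0%VS -> (nu <= k)%N.

(** * Complex parallelisable nilmanifolds *)

Definition holomorphic (R : realType) (V W : normedModType R[i]) (f : V -> W) : Prop :=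
  forall p : V, differentiable f p.

(* A simply connected nilpotent complex Lie group is biholomorphic, through its
   exponential map, to its Lie algebra; so, up to isomorphism, its underlying
   complex manifold is C^n with neutral element 0.  Its tangent space at 0 is
   C^n itself, and the left-invariant vector field with value y at 0 is
   a |-> 'D_y (mul a) 0; [cg_lie] says that L is the Lie algebra of
   left-invariant vector fields.  All derivatives are complex derivatives. *)
Record complex_group (R : realType) (n : nat) (L : lie_algebra R n) := ComplexGroup {
  cg_mul : 'rV[R[i]]_n -> 'rV[R[i]]_n -> 'rV[R[i]]_n;
  cg_inv : 'rV[R[i]]_n -> 'rV[R[i]]_n;
  cg_mulA : associative cg_mul;
  cg_mul0 : left_id 0 cg_mul;
  cg_mulV : left_inverse 0 cg_inv cg_mul;
  cg_mul_holo : holomorphic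
    (fun q : ('rV[R[i]]_n * 'rV[R[i]]_n)%type => cg_mul q.1 q.2);
  cg_inv_holo : holomorphic cg_inv;
  cg_lie : forall x y : 'rV[R[i]]_n,
    L x y = 'D_x (fun a => 'D_y (cg_mul a) 0) 0
          - 'D_y (fun a => 'D_x (cg_mul a) 0) 0 }.

(* [lat_cocompact]: the image of K in Gamma\G is everything. *)
Record lattice (R : realType) (n : nat) (L : lie_algebra R n)
    (G : complex_group L) := Lattice {
  lat :> set 'rV[R[i]]_n;
  lat0 : lat 0;
  latM : forall x y, lat x -> lat y -> lat (cg_mul G x y);
  latV : forall x, lat x -> lat (cg_inv G x);
  lat_discrete : exists2 U : set 'rV[R[i]]_n, nbhs (0 : 'rV[R[i]]_n) U & U `&` lat `<=` [set 0];
  lat_cocompact : exists2 K : set 'rV[R[i]]_n, compact K &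
    forall x, exists2 g, lat g & exists2 k, K k & x = cg_mul G g k }.

(* X = Gamma\G *)
Record nilmanifold (R : realType) (n : nat) := Nilmanifold {
  nm_lie : lie_algebra R n;
  nm_group : complex_group nm_lie;
  nm_lattice : lattice nm_group;
  nm_nilpotent : exists k, lower_central nm_lie k = 0%VS }.

(** * Hermitian metrics *)

Record hermitian_metric (R : realType) (n : nat) := HermitianMetric {
  herm :> 'rV[R[i]]_n -> 'rV[R[i]]_n -> R[i];
  herm_linear : forall (a : R[i]) x y z,
    herm (a *: x + y) z = a * herm x z + herm y z;
  herm_sym : forall x y, herm y x = (herm x y)^*;
  herm_pos : forall x, x != 0 -> 0 < herm x x }.

Record unitary_frame (R : realType) (n : nat) (h : hermitian_metric R n) :=
  UnitaryFrame {
    frame :> 'I_n -> 'rV[R[i]]_n;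
    frame_orthonormal : forall i j, h (frame i) (frame j) = (i == j)%:R }.

(** * The exterior algebra of gbar^* *)

(* Let e_0, ..., e_{n-1} be the given unitary frame of g, and ebar^0, ...,
   ebar^{n-1} the basis of gbar^* dual to its conjugate.  An element a of
   [ext R n] stands for the form \sum_S a S *: ebar^S, where
   ebar^S = ebar^{s_1} /\ ... /\ ebar^{s_k} for S = {s_1 < ... < s_k}. *)
Notation ext R n := {ffun {set 'I_n} -> (R[i])^o}.

Definition mono (R : realType) (n : nat) (S : {set 'I_n}) : ext R n :=
  [ffun T => (T == S)%:R].

(* Lambda^k gbar^* *)
Definition ext_deg (R : realType) (n k : nat) : {vspace ext R n} :=
  <<[seq mono R A | A in [pred A : {set 'I_n} | #|A| == k]]>>%VS.

Definition inversions (n : nat) (S T : {set 'I_n}) : nat :=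
  #|[pred p : 'I_n * 'I_n | [&& p.1 \in S, p.2 \in T & (p.2 < p.1)%N]]|.

Definition wedge (R : realType) (n : nat) (a b : ext R n) : ext R n :=
  [ffun U : {set 'I_n} => \sum_(S : {set 'I_n} | S \subset U)
     (-1) ^+ inversions S (U :\: S) * (a S * b (U :\: S))].

(* The metric induced on the exterior algebra is the one for which the
   monomials in a unitary coframe are orthonormal. *)
Definition ext_dot (R : realType) (n : nat) (a b : ext R n) : R[i] :=
  \sum_(S : {set 'I_n}) (a S : R[i]) * (b S : R[i])^*.

(** * The tensor product of the exterior algebra with g *)

(* u stands for \sum_S ebar^S (x) u S. *)
Notation extg R n := {ffun {set 'I_n} -> 'rV[R[i]]_n}.

Definition tens (R : realType) (n : nat) (a : ext R n) (x : 'rV[R[i]]_n) :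
    extg R n :=
  [ffun S => (a S : R[i]) *: x].

(* W (x) g *)
Definition tensg (R : realType) (n : nat) (W : {vspace ext R n}) :
    {vspace extg R n} :=
  <<[seq tens a x | a <- vbasis W, x <- vbasis fullv]>>%VS.

Definition extg_dot (R : realType) (n : nat) (h : hermitian_metric R n)
    (u v : extg R n) : R[i] :=
  \sum_(S : {set 'I_n}) h (u S) (v S).

Definition extg_norm (R : realType) (n : nat) (h : hermitian_metric R n)
    (u : extg R n) : R :=
  Num.sqrt (complex.Re (extg_dot h u u)).

(* p is the orthogonal projection of u to U. *)
Definition orth_proj (R : realType) (n : nat) (h : hermitian_metric R n)
    (U : {vspace extg R n}) (u : extg R n) : extg R n :=
  xget 0 [set p | p \in U /\ forall v, v \in U -> extg_dot h (u - p) v = 0].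

(* [a (x) x, b (x) y] = (a /\ b) (x) [x, y] *)
Definition schouten (R : realType) (n : nat) (L : lie_algebra R n)
    (u v : extg R n) : extg R n :=
  \sum_(S : {set 'I_n}) \sum_(T : {set 'I_n})
    tens (wedge (mono R S) (mono R T)) (L (u S) (v T)).

(** * The operator dbar and Hodge theory *)

Section Dolbeault.
Variables (R : realType) (n : nat) (L : lie_algebra R n).
Variables (h : hermitian_metric R n) (e : unitary_frame h).

(* (dbar ebar^k)(ebar_i, ebar_j) = - ebar^k([ebar_i, ebar_j]), and the latter is
   the conjugate of the k-th coordinate h([e_i, e_j], e_k) of [e_i, e_j]. *)
Definition dbar1 (k : 'I_n) : ext R n :=
  \sum_(i < n) \sum_(j < n | (i < j)%N)
    - (h (L (e i) (e j)) (e k))^* *: mono R [set i; j].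

(* The graded derivation extending [dbar1]; a 2-form may be moved to the front
   without a sign. *)
Definition dbar (a : ext R n) : ext R n :=
  \sum_(S : {set 'I_n}) (a S : R[i]) *: (\sum_(s in S)
    (-1) ^+ #|[pred j in S | (j < s)%N]| *: wedge (dbar1 s) (mono R (S :\ s))).

Definition dbarg (u : extg R n) : extg R n :=
  \sum_(S : {set 'I_n}) tens (dbar (mono R S)) (u S).

Definition dbar_adj (b : ext R n) : ext R n :=
  xget 0 [set c | forall a, ext_dot (dbar a) b = ext_dot a c].

Definition laplacian (a : ext R n) : ext R n :=
  dbar (dbar_adj a) + dbar_adj (dbar a).

(* H^k, B^k and V^k; as dbar vanishes on constants, B^0 = 0 as it should. *)
Definition hodge_harmonic (k : nat) : {vspace ext R n} :=
  (ext_deg R n k :&: lker (linfun laplacian))%VS.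
Definition hodge_exact (k : nat) : {vspace ext R n} :=
  (linfun dbar @: ext_deg R n k.-1)%VS.
Definition hodge_coexact (k : nat) : {vspace ext R n} :=
  (linfun dbar_adj @: ext_deg R n k.+1)%VS.

Definition proj_exact : extg R n -> extg R n := orth_proj h (tensg (hodge_exact 2)).
Definition proj_harmonic : extg R n -> extg R n :=
  orth_proj h (tensg (hodge_harmonic 2)).

(* the inverse of dbar : V^1 (x) g -> B^2 (x) g *)
Definition delta (b : extg R n) : extg R n :=
  xget 0 [set v | v \in tensg (hodge_coexact 1) /\ dbarg v = b].

(** * The Kuranishi family *)

(* [:: 0; Phi_1; ...; Phi_k]; the entry of index 0 is a dummy. *)
Fixpoint Phi_seq (mu : extg R n) (k : nat) : seq (extg R n) :=
  if k is k'.+1 then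
    let s := Phi_seq mu k' in
    rcons s (if k' == 0%N then mu
             else - delta (proj_exact
                    (\sum_(1 <= i < k) schouten L (nth 0 s i) (nth 0 s (k - i)))))
  else [:: 0].

Definition Phi_ (mu : extg R n) (k : nat) : extg R n := nth 0 (Phi_seq mu k) k.

Lemma size_Phi_seq mu k : size (Phi_seq mu k) = k.+1.
Proof. by elim: k => //= k IHk; rewrite size_rcons IHk. Qed.

Lemma nth_Phi_seq mu k i : (i <= k)%N -> nth 0 (Phi_seq mu k) i = Phi_ mu i.
Proof.
elim: k => [|k IHk]; first by rewrite leqn0 => /eqP->.
rewrite leq_eqVlt ltnS => /predU1P[-> //|le_ik].
by rewrite -IHk //= nth_rcons size_Phi_seq ltnS le_ik.
Qed.

Lemma Phi_1 mu : Phi_ mu 1 = mu. Proof. by []. Qed.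

Lemma Phi_rec mu k : (2 <= k)%N ->
  Phi_ mu k = - delta (proj_exact
    (\sum_(1 <= i < k) schouten L (Phi_ mu i) (Phi_ mu (k - i)))).
Proof.
case: k => [//|[//|k]] _; rewrite {1}/Phi_.
have -> : Phi_seq mu k.+2 = rcons (Phi_seq mu k.+1) (- delta (proj_exact
    (\sum_(1 <= i < k.+2) schouten L (nth 0 (Phi_seq mu k.+1) i)
                                     (nth 0 (Phi_seq mu k.+1) (k.+2 - i))))) by [].
rewrite nth_rcons size_Phi_seq ltnn eqxx; congr (- delta (proj_exact _)).
rewrite big_nat [RHS]big_nat; apply: eq_bigr => -[//|i] /andP[_ i_lt].
by rewrite !nth_Phi_seq // subSS leq_subr.
Qed.

(* Phi = \sum_(k >= 1) Phi_k, and its convergence, component by component *)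
Definition Phi_cvg (mu : extg R n) : Prop :=
  forall S, cvgn (fun N => \sum_(1 <= k < N) Phi_ mu k S).

Definition Phi (mu : extg R n) : extg R n :=
  [ffun S => limn (fun N => \sum_(1 <= k < N) Phi_ mu k S)].

Definition obs (mu : extg R n) : extg R n :=
  proj_harmonic (schouten L (Phi mu) (Phi mu)).

(* mu(t) = \sum_(i, j) t_i^j w_i (x) X_j *)
Definition mu_of (m : nat) (w : m.-tuple (ext R n)) (X : n.-tuple 'rV[R[i]]_n)
    (t : 'M[R[i]]_(m, n)) : extg R n :=
  \sum_(i < m) \sum_(j < n) t i j *: tens (tnth w i) (tnth X j).

End Dolbeault.

(** * Closed complex subspaces of an open set *)

(* Germs are represented by functions defined on all of V. *)
Definition holomorphic_at (R : realType) (V : normedModType R[i])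
    (f : V -> (R[i])^o) (p : V) : Prop :=
  \forall q \near p, differentiable f q.

Definition germ_ideal (R : realType) (V : normedModType R[i]) (N : nat)
    (f : 'I_N -> V -> (R[i])^o) (p : V) : set (V -> (R[i])^o) :=
  [set g | exists a : 'I_N -> V -> (R[i])^o,
     (forall l, holomorphic_at (a l) p) /\
     \forall q \near p, g q = \sum_(l < N) (a l q : R[i]) * f l q].

(* A closed complex subspace, given by its support and the stalks of its
   ideal sheaf. *)
Record complex_subspace (R : realType) (V : normedModType R[i]) := ComplexSubspace {
  cs_support : set V;
  cs_ideal : V -> set (V -> (R[i])^o) }.

(* The subspace of the open set D cut out by holomorphic functions f_l *)
Definition cut_out (R : realType) (V : normedModType R[i]) (D : set V) (N : nat)
    (f : 'I_N -> V -> (R[i])^o) : complex_subspace V :=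
  {| cs_support := [set p | D p /\ forall l, f l p = 0];
     cs_ideal := fun p => [set g | D p /\ germ_ideal f p g] |}.

Section Kuranishi.
Variables (R : realType) (n : nat) (L : lie_algebra R n).
Variables (h : hermitian_metric R n) (e : unitary_frame h).
Variables (m : nat) (w : m.-tuple (ext R n)) (X : n.-tuple 'rV[R[i]]_n).

(* The ball of radius eps in H^1 (x) g, in the coordinates t. *)
Definition mu_ball (eps : R) : set 'M[R[i]]_(m, n) :=
  [set t | extg_norm h (mu_of w X t) < eps].

Definition obs_component (l : 'I_(\dim (tensg (hodge_harmonic L e 2))))
    (t : 'M[R[i]]_(m, n)) : (R[i])^o :=
  coord (vbasis (tensg (hodge_harmonic L e 2))) l (obs L e (mu_of w X t)).

Definition Kur (eps : R) : complex_subspace 'M[R[i]]_(m, n) :=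
  cut_out (mu_ball eps) obs_component.

End Kuranishi.

(* polynomial functions of the m * n variables t_i^j *)
Definition poly_fun (R : realType) (m n : nat)
    (F : mpoly.mpoly (m * n) R[i]) (t : 'M[R[i]]_(m, n)) : (R[i])^o :=
  mpoly.meval (fun k => mxvec t 0 k) F.

(* The measure instance behind [mpoly.msize] is not visible without importing
   mpoly, whose notations clash with those of Analysis. *)
Definition degree_le (R : realType) (k : nat) (F : mpoly.mpoly k R[i]) (d : nat) : Prop :=
  forall u, mpoly.mcoeff u F != 0 -> (mpoly.mdeg u <= d)%N.

(* Main.v *)
(* Orthogonal projections onto W (x) g and the inverse of dbar act on the form
   factor only, i.e. they are of the form A (x) id, so they preserve
   Lambda gbar^* (x) C_k g for every k.  As [C_a g, C_b g] lies in C_(a+b+1) g,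
   induction gives that Phi_k has coefficients in C_(k-1) g and [Phi_i, Phi_j]
   has coefficients in C_(i+j-1) g, which is 0 as soon as i + j > nu.  Hence the
   series Phi is finite, and bilinearity of the bracket gives the formula for
   obs.  Moreover Phi_k is polynomial of degree at most k in t, because all the
   operators involved are linear. *)

Require Import Defs.
From HB Require Import structures.
From mathcomp Require Import all_boot all_order all_algebra.
From mathcomp Require Import complex.
From mathcomp Require Import all_classical all_reals topology normedtype sequences derive.
From mathcomp Require mpoly.

Import Order.TTheory GRing.Theory Num.Theory.
Import numFieldNormedType.Exports.

Local Open Scope ring_scope.

Set Implicit Arguments.
Unset Strict Implicit.

(** * Linear functions and spans *)

Section LinearSpan.
Variables (K : fieldType) (aT rT : vectType K).
Implicit Type f : aT -> rT.

(** The operators below are bare functions with a separate proof of linearity. This passes to the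
    bundled map, whose library lemmas then carry over to [f]. *)
Lemma linfun_linearE f : linear f -> linfun f =1 f.
Proof.
move=> f_lin x.
pose g : {linear aT -> rT} := HB.pack f (GRing.isLinear.Build _ _ _ _ f f_lin).
by rewrite -[f]/(g : aT -> rT) lfunE.
Qed.

Lemma is_linearD f : linear f -> {morph f : x y / x + y}.
Proof. by move=> f_lin x y; rewrite -!(linfun_linearE f_lin) linearD. Qed.

Lemma is_linearB f : linear f -> {morph f : x y / x - y}.
Proof. by move=> f_lin x y; rewrite -!(linfun_linearE f_lin) linearB. Qed.

Lemma is_linearZ f a : linear f -> {morph f : x / a *: x}.
Proof. by move=> f_lin x; rewrite -!(linfun_linearE f_lin) linearZ. Qed.

Lemma is_linear0 f : linear f -> f 0 = 0.
Proof. by move=> f_lin; rewrite -(linfun_linearE f_lin) linear0. Qed.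

Lemma is_linear_sum (I : Type) (r : seq I) (P : pred I) (F : I -> aT) f :
  linear f -> f (\sum_(i <- r | P i) F i) = \sum_(i <- r | P i) f (F i).
Proof.
move=> f_lin; rewrite -(linfun_linearE f_lin) linear_sum.
by apply: eq_bigr => i _; exact: linfun_linearE.
Qed.

(** Reduces statements about a span to its generators. With [U] the zero space it also shows that a
    linear form vanishing on generators vanishes on the span. *)
Lemma memv_linear_span f (s : seq aT) (U : {vspace rT}) :
  linear f -> {in s, forall x, f x \in U} -> {in <<s>>%VS, forall x, f x \in U}.
Proof.
move=> f_lin fU x xs; rewrite -(linfun_linearE f_lin).
apply: (subvP _ _ (memv_img (linfun f) xs)).
rewrite limg_span; apply/span_subvP => _ /mapP[y ys ->].
by rewrite linfun_linearE //; exact: fU.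
Qed.

End LinearSpan.

(** * Brackets in the descending central series *)

Section LowerCentral.
Variables (R : realType) (n : nat) (L : lie_algebra R n).
Implicit Types x y z : 'rV[R[i]]_n.

Lemma lie_anti x y : L x y = - L y x.
Proof.
have := lie_alt L (x + y).
rewrite (is_linearD (lie_linearl L _)) !(is_linearD (lie_linearr L _)).
by rewrite !lie_alt add0r addr0 => /eqP; rewrite addr_eq0 => /eqP.
Qed.

Lemma memv_lower_centralS k x y :
  x \in lower_central L k -> L x y \in lower_central L k.+1.
Proof.
rewrite -{1}(span_basis (vbasisP (lower_central L k))).
apply: (memv_linear_span (lie_linearl L y)) => {}x xk.
have: y \in <<vbasis fullv>>%VS by rewrite (span_basis (vbasisP _)) memvf.
apply: (memv_linear_span (lie_linearr L x)) => {}y yk.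
by apply: memv_span; apply: allpairs_f.
Qed.

(** Induction on [b]. On a generator [y, z] of the next term, with y in C_b, Jacobi turns [x,
    [y, z]] into brackets of y with [z, x] and of z with [x, y]. The first is covered by induction
    with [a.+1], the second by induction followed by one more bracket. *)
Lemma memv_lie_lower_central a b x y :
  x \in lower_central L a -> y \in lower_central L b ->
  L x y \in lower_central L (a + b).+1.
Proof.
elim: b a x y => [|b IHb] a x y xa; first by rewrite addn0 => _; exact: memv_lower_centralS.
apply: (memv_linear_span (lie_linearr L x)) => w /allpairsP[[{}y z] [/vbasis_mem yb _ ->]].
move: yb; rewrite -/(lower_central L b) [fst _]/= [snd _]/= => yb.
have /eqP := lie_jacobi L x y z; rewrite -addrA addr_eq0 => /eqP ->.
rewrite memvN addnS; apply: memvD; rewrite lie_anti memvN.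
  rewrite -addSn; apply: IHb => //.
  by rewrite lie_anti memvN; apply: memv_lower_centralS.
by apply: memv_lower_centralS; apply: IHb.
Qed.

Lemma lower_central_eq0 nu k : lower_central L nu = 0%VS -> (nu <= k)%N ->
  lower_central L k = 0%VS.
Proof.
move=> nu0 /subnK <-; elim: (k - nu)%N => //= d IHd.
apply/eqP; rewrite -subv0; apply/span_subvP => _ /allpairsP[[x y] /= [xk _ ->]].
have /eqP-> : x == 0 by rewrite -memv0 -IHd; exact: vbasis_mem.
by rewrite (is_linear0 (lie_linearl L y)) mem0v.
Qed.

End LowerCentral.

(** * The hermitian product on forms and orthogonal projection *)

Section Hermitian.
Variables (R : realType) (n : nat).
Implicit Types a b c : ext R n.
Implicit Types u v : extg R n.

Lemma mono_sum a : a = \sum_(S : {set 'I_n}) (a S : R[i]) *: mono R S.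
Proof.
apply/ffunP => T; rewrite sum_ffunE (bigD1 T) //= !ffunE eqxx.
rewrite big1 ?addr0 => [|S ST]; first by rewrite [RHS]mulr1.
by rewrite !ffunE eq_sym (negbTE ST) scaler0.
Qed.

Lemma ext_dot_linearl b : linear (fun a => ext_dot a b : (R[i])^o).
Proof.
move=> z a c; rewrite /ext_dot scaler_sumr -big_split /=.
by apply: eq_bigr => S _; rewrite !ffunE mulrDl -mulrA.
Qed.

Lemma ext_dotC a b : ext_dot b a = (ext_dot a b)^*.
Proof.
rewrite /ext_dot rmorph_sum; apply: eq_bigr => S _.
by rewrite rmorphM /= conjCK mulrC.
Qed.

Lemma ext_dot_eq0 a : ext_dot a a = 0 -> a = 0.
Proof.
move=> a0; apply/ffunP => S; rewrite ffunE.
have ge0 T : true -> 0 <= (a T : R[i]) * (a T : R[i])^* by rewrite mul_conjC_ge0.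
have /eqP := psumr_eq0P ge0 a0 (i := S) isT.
by rewrite mul_conjC_eq0 => /eqP.
Qed.

Lemma ext_dotZl z a b : ext_dot (z *: a) b = z * ext_dot a b.
Proof. exact: (is_linearZ z (ext_dot_linearl b) a). Qed.

Lemma ext_dotDl a b c : ext_dot (a + b) c = ext_dot a c + ext_dot b c.
Proof. exact: is_linearD (ext_dot_linearl c) _ _. Qed.

Lemma ext_dotBl a b c : ext_dot (a - b) c = ext_dot a c - ext_dot b c.
Proof. exact: is_linearB (ext_dot_linearl c) _ _. Qed.

Lemma ext_dotBr a b c : ext_dot a (b - c) = ext_dot a b - ext_dot a c.
Proof. by rewrite ext_dotC ext_dotBl rmorphB /= -!ext_dotC. Qed.

Lemma ext_dotDr a b c : ext_dot a (b + c) = ext_dot a b + ext_dot a c.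
Proof. by rewrite ext_dotC ext_dotDl rmorphD /= -!ext_dotC. Qed.

Lemma ext_dotZr z a b : ext_dot a (z *: b) = z^* * ext_dot a b.
Proof. by rewrite ext_dotC ext_dotZl rmorphM /= -ext_dotC. Qed.

Lemma ext_dot0l b : ext_dot (0 : ext R n) b = 0.
Proof. exact: is_linear0 (ext_dot_linearl b). Qed.

(** Supplies a projection on forms alone; acting on the form factor, it will be identified with the
    choice-defined [orth_proj] on the tensor product. *)
Lemma orth_proj_ext_exists (W : {vspace ext R n}) : exists p : ext R n -> ext R n,
  [/\ linear p, forall a, p a \in W
    & forall a, {in W, forall b, ext_dot b (a - p a) = 0}].
Proof.
rewrite -(span_basis (vbasisP W)).
elim: (vbasis W : seq _) => [|x s [p [p_lin p_mem p_perp]]].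
  exists (fun=> 0); split=> [z a b|a|a b]; first by rewrite scaler0 addr0.
    exact: mem0v.
  by rewrite span_nil memv0 => /eqP ->; rewrite ext_dot0l.
(* Gram-Schmidt; when y = 0 the added term vanishes, whatever its coefficient. *)
have [y y_def] : exists y, y = x - p x by eexists.
pose q a := (ext_dot a y / ext_dot y y) *: y.
have sub_s : (<<s>> <= <<x :: s>>)%VS by rewrite span_cons addvSr.
have y_mem : y \in <<x :: s>>%VS.
  by rewrite y_def; apply: memvB; [rewrite memv_span ?mem_head | apply: (subvP sub_s)].
exists (fun a => p a + q a); split=> [z a b|a|a b].
- rewrite p_lin /q ext_dotDl ext_dotZl.
  by rewrite mulrDl scalerDl scalerDr addrACA scalerA mulrA.
- by rewrite memvD ?memvZ ?y_mem ?(subvP sub_s).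
rewrite span_cons => /memv_addP[_ /vlineP[k ->] [b' b's ->]].
(* As x = y + p x, a vector of the enlarged span splits into a multiple of y and a vector of
   [<<s>>], which are orthogonal to each other. *)
have -> : k *: x + b' = k *: y + (b' + k *: p x).
  by rewrite y_def scalerBr [b' + _]addrC addrA subrK.
move: (b' + k *: p x) (memvD b's (memvZ k (p_mem x))) => c cs.
rewrite opprD addrA ext_dotDl ext_dotZl !(ext_dotBr _ (a - p a)) (p_perp a c cs).
have cy : ext_dot c y = 0 by rewrite y_def p_perp.
rewrite !ext_dotZr cy mulr0 subr0 addr0 ext_dotBr.
have -> : ext_dot y (p a) = 0 by rewrite ext_dotC y_def p_perp ?conjC0.
rewrite subr0 rmorphM fmorphV /= -!ext_dotC.
have [->|y_neq0] := eqVneq y 0; first by rewrite !ext_dot0l mulr0 subrr mulr0.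
by rewrite divfK ?subrr ?mulr0 //; apply: contra_neq y_neq0; exact: ext_dot_eq0.
Qed.

End Hermitian.

(** * Operators acting on the form factor only *)

Section Tensor.
Variables (R : realType) (n : nat).
Implicit Types (a b c : ext R n) (x y : 'rV[R[i]]_n) (u v : extg R n).
Implicit Types (f : 'rV[R[i]]_n -> (R[i])^o) (A : ext R n -> ext R n).
Implicit Type W : {vspace ext R n}.

Definition coordf (j : 'I_n) x : (R[i])^o := x 0 j.

Lemma coordf_linear j : linear (coordf j).
Proof. by move=> z x y; rewrite /coordf !mxE. Qed.

(* id (x) f *)
Definition slice f u : ext R n := [ffun S => f (u S)].

(* A (x) id *)
Definition opg A u : extg R n := \sum_(S : {set 'I_n}) tens (A (mono R S)) (u S).

Lemma slice_linear f : linear f -> linear (slice f).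
Proof.
by move=> f_lin z u v; apply/ffunP => S; rewrite !ffunE f_lin.
Qed.

(** Together with [slice_opg] this reduces identities between g-valued forms to identities between
    scalar forms, one for each coordinate of g. *)
Lemma slice_inj u v : (forall j, slice (coordf j) u = slice (coordf j) v) -> u = v.
Proof.
move=> uv; apply/ffunP => S; apply/rowP => j.
by have /ffunP/(_ S) := uv j; rewrite !ffunE.
Qed.

Lemma slice_tens f a x : linear f -> slice f (tens a x) = f x *: a.
Proof.
move=> f_lin; apply/ffunP => S; rewrite !ffunE (is_linearZ _ f_lin).
exact: mulrC.
Qed.

Lemma opgE A u T : opg A u T = \sum_(S : {set 'I_n}) (A (mono R S) T : R[i]) *: u S.
Proof. by rewrite sum_ffunE; apply: eq_bigr => S _; rewrite ffunE. Qed.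

Lemma opg_linear A : linear (opg A).
Proof.
move=> z u v; apply/ffunP => T; rewrite !(opgE, ffunE) scaler_sumr -big_split.
by apply: eq_bigr => S _; rewrite !ffunE scalerDr !scalerA mulrC.
Qed.

(** A (x) id and id (x) f act on different factors, hence commute; both sides are compared on
    monomials. *)
Lemma slice_opg f A u : linear f -> linear A -> slice f (opg A u) = A (slice f u).
Proof.
move=> f_lin A_lin; rewrite /opg (is_linear_sum _ _ _ (slice_linear f_lin)).
rewrite [in RHS](mono_sum (slice f u)) (is_linear_sum _ _ _ A_lin).
apply: eq_bigr => S _; rewrite slice_tens // (is_linearZ _ A_lin).
by rewrite ffunE.
Qed.

Lemma tens_linearl x : linear (fun a => tens a x).
Proof. by move=> z a b; apply/ffunP => S; rewrite !ffunE scalerDl scalerA. Qed.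

Lemma tens_linearr a : linear (tens a).
Proof.
by move=> z x y; apply/ffunP => S; rewrite !ffunE scalerDr !scalerA mulrC.
Qed.

Lemma memv_tens W a x : a \in W -> tens a x \in tensg W.
Proof.
rewrite -{1}(span_basis (vbasisP W)).
apply: (memv_linear_span (tens_linearl x)) => {}a aW.
have: x \in <<vbasis fullv>>%VS by rewrite (span_basis (vbasisP _)) memvf.
apply: (memv_linear_span (tens_linearr a)) => {}x xV.
by apply: memv_span; apply: allpairs_f.
Qed.

Lemma memv_slice W f u : linear f -> u \in tensg W -> slice f u \in W.
Proof.
move=> f_lin; apply: (memv_linear_span (slice_linear f_lin)).
move=> _ /allpairsP[[a x] [/vbasis_mem aW _ ->]].
by rewrite slice_tens // memvZ.
Qed.

Lemma tens_slice_sum u :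
  u = \sum_(j < n) tens (slice (coordf j) u) (delta_mx 0 j).
Proof.
apply/ffunP => S; rewrite sum_ffunE [LHS]row_sum_delta.
by apply: eq_bigr => j _; rewrite !ffunE.
Qed.

Lemma mem_tensgP W u : (forall j, slice (coordf j) u \in W) -> u \in tensg W.
Proof.
by move=> uW; rewrite (tens_slice_sum u) memv_suml // => j _; exact: memv_tens.
Qed.

Lemma mem_opg W A u : linear A -> (forall a, A a \in W) -> opg A u \in tensg W.
Proof.
move=> A_lin AW; apply: mem_tensgP => j.
by rewrite slice_opg //; exact: coordf_linear.
Qed.

(** The coefficients of [opg A u] are linear combinations of those of [u]. This is why such
    operators respect the filtration by the central series. *)
Lemma opg_coef A u (C : {vspace 'rV[R[i]]_n}) :
  (forall S, u S \in C) -> forall S, opg A u S \in C.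
Proof. by move=> uC S; rewrite opgE memv_suml // => T _; rewrite memvZ. Qed.

Variable h : hermitian_metric R n.

Lemma herm_linearl y : linear (fun x => h x y : (R[i])^o).
Proof. by move=> z x x'; exact: herm_linear. Qed.

Lemma extg_dot_linearl v : linear (fun u => extg_dot h u v : (R[i])^o).
Proof.
move=> z u u'; rewrite /extg_dot scaler_sumr -big_split.
by apply: eq_bigr => S _; rewrite !ffunE herm_linear.
Qed.

Lemma extg_dotC u v : extg_dot h v u = (extg_dot h u v)^*.
Proof.
by rewrite /extg_dot rmorph_sum; apply: eq_bigr => S _; exact: herm_sym.
Qed.

Lemma extg_dot_eq0 u : extg_dot h u u = 0 -> u = 0.
Proof.
have ge0 x : 0 <= h x x.
  have [->|/(herm_pos h)/ltW //] := eqVneq x 0.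
  by have := is_linear0 (herm_linearl 0) => /= ->.
move=> u0; apply/ffunP => S; rewrite ffunE.
have /eqP := psumr_eq0P (fun T _ => ge0 (u T)) u0 (i := S) isT.
by apply: contraTeq => /(herm_pos h); rewrite lt0r => /andP[].
Qed.

(** Slicing along the linear form h(-, x) brings orthogonality to simple tensors back to
    orthogonality of forms. *)
Lemma extg_dot_tens u a x :
  extg_dot h (tens a x) u = ext_dot a (slice (fun y => h y x) u).
Proof.
rewrite /extg_dot; apply: eq_bigr => S _; rewrite !ffunE -herm_sym.
exact: is_linearZ (a S) (herm_linearl (u S)) x.
Qed.

(** [opg p u] satisfies both conditions that define [orth_proj], and positive definiteness makes
    their solution unique, so the choice must return it. *)
Lemma orth_proj_opg W (p : ext R n -> ext R n) u : linear p ->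
  (forall a, p a \in W) -> (forall a, {in W, forall b, ext_dot b (a - p a) = 0}) ->
  orth_proj h (tensg W) u = opg p u.
Proof.
move=> p_lin p_mem p_perp; have pu_mem := mem_opg u p_lin p_mem.
have pu_perp v : v \in tensg W -> extg_dot h v (u - opg p u) = 0.
  (* Vanishing is phrased as membership in the zero space, so that it need only be checked on
     tensors a (x) x with a in [W]. *)
  move=> vW; suff: (extg_dot h v (u - opg p u) : (R[i])^o) \in 0%VS.
    by rewrite memv0 => /eqP.
  apply: (memv_linear_span (extg_dot_linearl _) _ vW).
  move=> _ /allpairsP[[a x] [/vbasis_mem aW _ ->]].
  have s_lin := herm_linearl x.
  rewrite extg_dot_tens (is_linearB (slice_linear s_lin)) slice_opg //.
  by rewrite p_perp ?mem0v.
apply: xget_unique => [|q [qW q_perp]].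
  by split=> // v vW; rewrite extg_dotC pu_perp ?conjC0.
apply/eqP; rewrite -subr_eq0; apply/eqP/extg_dot_eq0.
have dW : q - opg p u \in tensg W by rewrite memvB.
have := q_perp _ dW; have := pu_perp _ dW; rewrite extg_dotC => /eqP.
rewrite conjC_eq0 => /eqP pd qd.
(* The vector q - [opg p u] lies in W (x) g and is the difference of two residuals orthogonal to W
   (x) g, so it is orthogonal to itself. *)
have /= := is_linearB (extg_dot_linearl (q - opg p u)) (u - opg p u) (u - q).
by rewrite pd qd subr0 opprB [X in extg_dot h X _]addrC addrA subrK.
Qed.

End Tensor.

(** * Degrees, the adjoint of dbar, and the inverse of dbar *)

Section Dolbeault.
Variables (R : realType) (n : nat) (L : lie_algebra R n).
Variables (h : hermitian_metric R n) (e : unitary_frame h).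
Implicit Types (a b c : ext R n) (S T U : {set 'I_n}).
Local Notation dbar := (dbar L e).
Local Notation dbar_adj := (dbar_adj L e).

Lemma mem_ext_degP k a :
  reflect (forall S, #|S| != k -> a S = 0) (a \in ext_deg R n k).
Proof.
apply: (iffP idP) => [ak S Sk | a0].
  suff: (a S : (R[i])^o) \in 0%VS by rewrite memv0 => /eqP.
  have ev_lin : linear (fun a : ext R n => a S : (R[i])^o).
    by move=> z b c; rewrite !ffunE.
  rewrite /ext_deg in ak; apply: (memv_linear_span ev_lin _ ak) => _ /mapP[T Tk ->].
  rewrite mem_enum inE in Tk; rewrite ffunE.
  by have [ST|_] := eqVneq S T; [rewrite ST Tk in Sk | exact: mem0v].
rewrite (mono_sum a) memv_suml // => S _.
have [Sk|/a0 ->] := boolP (#|S| == k); last by rewrite scale0r mem0v.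
by apply/memvZ/memv_span/map_f; rewrite mem_enum inE Sk.
Qed.

Lemma mem_ext_deg_neq0 k a : (forall S, a S != 0 -> #|S| = k) -> a \in ext_deg R n k.
Proof.
by move=> aP; apply/mem_ext_degP => S; apply: contraNeq => /aP ->.
Qed.

Lemma ext_deg_neq0 k a S : a \in ext_deg R n k -> a S != 0 -> #|S| = k.
Proof. by move/mem_ext_degP => aP; apply: contraNeq => /aP/eqP. Qed.

Lemma mono_deg S : mono R S \in ext_deg R n #|S|.
Proof.
by apply: mem_ext_deg_neq0 => T; rewrite ffunE; have [->|_] := eqVneq T S; rewrite ?eqxx.
Qed.

Lemma wedge_deg p q a b : a \in ext_deg R n p -> b \in ext_deg R n q ->
  wedge a b \in ext_deg R n (p + q).
Proof.
move=> ap bq; apply/mem_ext_degP => U Upq; rewrite ffunE big1 // => S SU.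
apply/eqP; move: Upq; apply: contraNT.
rewrite !mulf_eq0 !negb_or => /and3P[_ /(ext_deg_neq0 ap) <- /(ext_deg_neq0 bq) <-].
by rewrite cardsD (finset.setIidPr SU) subnKC // subset_leq_card.
Qed.

Lemma dbar1_deg k : dbar1 L e k \in ext_deg R n 2.
Proof.
rewrite /dbar1 memv_suml // => i _; rewrite memv_suml // => j ij.
rewrite memvZ //; have := mono_deg [set i; j].
by rewrite cards2 neq_ltn ij.
Qed.

Lemma dbar_linear : linear dbar.
Proof.
move=> z a b; rewrite /dbar scaler_sumr -big_split.
by apply: eq_bigr => S _; rewrite !ffunE scalerDl scalerA.
Qed.

Lemma dbar_deg k a : a \in ext_deg R n k -> dbar a \in ext_deg R n k.+1.
Proof.
move=> ak; rewrite /dbar memv_suml // => S _.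
have [->|/(ext_deg_neq0 ak) Sk] := eqVneq (a S) 0; first by rewrite scale0r mem0v.
rewrite memvZ // memv_suml // => s sS; rewrite memvZ //.
have := wedge_deg (dbar1_deg s) (mono_deg (S :\ s)).
by rewrite -Sk (cardsD1 s S) sS.
Qed.

Lemma ext_dot_mono S a : ext_dot (mono R S) a = (a S : R[i])^*.
Proof.
rewrite /ext_dot (bigD1 S) //= ffunE eqxx mul1r big1 ?addr0 // => T TS.
by rewrite ffunE (negbTE TS) mul0r.
Qed.

Lemma ext_dot_inj a b : (forall c, ext_dot c a = ext_dot c b) -> a = b.
Proof.
move=> ab; apply/eqP; rewrite -subr_eq0; apply/eqP/ext_dot_eq0.
by rewrite ext_dotBr ab subrr.
Qed.

(** [dbar_adj] is chosen among the solutions of this equation, so the point is that one exists. *)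
Lemma dbar_adjP a b : ext_dot (dbar a) b = ext_dot a (dbar_adj b).
Proof.
move: a; rewrite /Defs.dbar_adj; case: xgetP => [c _ // | no_adj].
(* Monomials are orthonormal and the product is conjugate-linear on the right, so testing on
   monomials forces these coefficients; linearity does the rest. *)
case: (no_adj [ffun S => (ext_dot (dbar (mono R S)) b)^*]) => a /=.
rewrite {1}(mono_sum a) (is_linear_sum _ _ _ dbar_linear).
rewrite (is_linear_sum _ _ _ (ext_dot_linearl b)) /=; apply: eq_bigr => S _.
by rewrite (is_linearZ _ dbar_linear) ext_dotZl ffunE conjCK.
Qed.

Lemma dbar_adj_linear : linear dbar_adj.
Proof.
move=> z a b; apply: ext_dot_inj => c.
by rewrite -dbar_adjP !ext_dotDr !ext_dotZr !dbar_adjP.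
Qed.

(** The coefficient at S is the conjugate of (dbar ebar^S, b), a product of forms of degrees #|S| +
    1 and k + 1. *)
Lemma dbar_adj_deg k b : b \in ext_deg R n k.+1 -> dbar_adj b \in ext_deg R n k.
Proof.
move=> bk; apply/mem_ext_degP => S Sk; apply/eqP.
rewrite -conjC_eq0 -ext_dot_mono -dbar_adjP; apply/eqP/big1 => T _.
have [->|] := eqVneq (b T) 0; first by rewrite conjC0 mulr0.
move/(ext_deg_neq0 bk) => Tk.
have /mem_ext_degP-> := dbar_deg (mono_deg S); first by rewrite mul0r.
by rewrite Tk eqSS eq_sym.
Qed.

Lemma hodge_coexactP k v :
  reflect (exists2 b, b \in ext_deg R n k.+1 & v = dbar_adj b)
          (v \in hodge_coexact L e k).
Proof.
apply: (iffP memv_imgP) => -[b bk ->]; exists b => //.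
  by rewrite (linfun_linearE dbar_adj_linear).
by rewrite (linfun_linearE dbar_adj_linear).
Qed.

(* If dbar (dbar_adj b) = 0 then |dbar_adj b|^2 = (dbar (dbar_adj b), b) = 0. *)
Lemma dbar_coexact_inj k v : v \in hodge_coexact L e k -> dbar v = 0 -> v = 0.
Proof.
case/hodge_coexactP => b _ -> db0; apply: ext_dot_eq0.
by rewrite -dbar_adjP db0 ext_dot0l.
Qed.

(** Let b = dbar a and let p be the projection to V^k. With r = a - p a orthogonal to V^k, |dbar
    r|^2 = (r, dbar_adj (dbar r)) = 0, so p a is a preimage of b. *)
Lemma dbar_coexact_surj k b : b \in hodge_exact L e k.+1 ->
  exists2 v, v \in hodge_coexact L e k & dbar v = b.
Proof.
case/memv_imgP => a ak ->; rewrite (linfun_linearE dbar_linear).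
have [p [_ p_mem p_perp]] := orth_proj_ext_exists (hodge_coexact L e k).
exists (p a) => //; apply/eqP; rewrite eq_sym -subr_eq0 -(is_linearB dbar_linear).
have pak : p a \in ext_deg R n k.
  by have /hodge_coexactP[c ck ->] := p_mem a; exact: dbar_adj_deg.
apply/eqP/ext_dot_eq0; rewrite dbar_adjP ext_dotC p_perp ?conjC0 //.
by apply/hodge_coexactP; exists (dbar (a - p a)) => //; apply/dbar_deg/memvB.
Qed.

(** The inverse of dbar : V^1 -> B^2 on scalar forms is extended to a linear A on all forms; A (x)
    id then meets the specification of [delta], whose solution is unique since dbar is injective on
    V^1. *)
Lemma delta_opg : exists2 A : ext R n -> ext R n, linear A &
  {in tensg (hodge_exact L e 2), delta L e =1 opg A}.
Proof.
have [p [p_lin p_mem p_perp]] := orth_proj_ext_exists (hodge_coexact L e 1).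
have dp_lin : linear (fun a => dbar (p a)).
  by move=> z a b; rewrite p_lin dbar_linear.
(* [f^-1] is a linear map that is a right inverse of [f] on its image; composing with [p] puts the
   values in V^1. *)
pose f := linfun (fun a => dbar (p a)); pose A a := p (f^-1 a)%VF.
have A_lin : linear A by move=> z a b; rewrite /A linearP p_lin.
have AK b : b \in hodge_exact L e 2 -> dbar (A b) = b.
  move=> bB; have <- : f (f^-1 b)%VF = dbar (A b) by exact: linfun_linearE.
  apply: limg_lfunVK.
  (* B^2 lies in the image of [f]: a preimage v in V^1 is fixed by [p], so dbar v = [f v]. *)
  have [v vV <-] := dbar_coexact_surj bB.
  suff -> : dbar v = f v by exact: memv_img (memvf v).
  rewrite (linfun_linearE dp_lin); congr (dbar _).
  apply/eqP; rewrite -subr_eq0; apply/eqP/ext_dot_eq0.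
  by rewrite p_perp // memvB.
have dbargE u : dbarg L e u = opg dbar u by [].
exists A => // b bB; apply: xget_unique => [|v [vV dv]].
  split; first by apply: mem_opg => // a; exact: p_mem.
  apply: slice_inj => j; have c_lin := @coordf_linear R n j.
  rewrite dbargE !slice_opg ?AK //; last exact: dbar_linear.
  exact: memv_slice.
apply: slice_inj => j; have c_lin := @coordf_linear R n j.
apply/eqP; rewrite -subr_eq0 slice_opg //.
apply/eqP/(@dbar_coexact_inj 1).
  by rewrite memvB ?p_mem // memv_slice.
rewrite (is_linearB dbar_linear) AK; last exact: memv_slice.
by rewrite -slice_opg //; [rewrite -dbargE dv subrr | exact: dbar_linear].
Qed.

Lemma proj_harmonic_opg : exists2 A : ext R n -> ext R n, linear A &
  proj_harmonic L e =1 opg A.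
Proof.
have [p [p_lin p_mem p_perp]] := orth_proj_ext_exists (hodge_harmonic L e 2).
by exists p => // u; exact: orth_proj_opg.
Qed.

(** [delta] is known to be of the form A (x) id only on B^2 (x) g, which is exactly where
    [proj_exact] takes its values. *)
Lemma delta_proj_exact_opg : exists2 A : ext R n -> ext R n, linear A &
  forall u, delta L e (proj_exact L e u) = opg A u.
Proof.
have [p [p_lin p_mem p_perp]] := orth_proj_ext_exists (hodge_exact L e 2).
have [d d_lin deltaE] := delta_opg.
exists (d \o p) => [z a b|u] /=; first by rewrite p_lin d_lin.
rewrite /proj_exact (orth_proj_opg h u p_lin p_mem p_perp) deltaE ?mem_opg //.
apply: slice_inj => j; have c_lin := @coordf_linear R n j.
by rewrite !slice_opg // => z a b /=; rewrite p_lin d_lin.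
Qed.

End Dolbeault.

(** * Filtration of the series and the finite formula for obs *)

Section Obstruction.
Variables (R : realType) (n : nat) (L : lie_algebra R n).
Variables (h : hermitian_metric R n) (e : unitary_frame h).
Implicit Types (u v mu : extg R n) (S T : {set 'I_n}).

Lemma schouten_linearl v : linear (fun u => schouten L u v).
Proof.
move=> z u u'; rewrite /schouten scaler_sumr -big_split; apply: eq_bigr => S _.
rewrite scaler_sumr -big_split; apply: eq_bigr => T _.
by rewrite !ffunE lie_linearl tens_linearr.
Qed.

Lemma schouten_linearr u : linear (schouten L u).
Proof.
move=> z v v'; rewrite /schouten scaler_sumr -big_split; apply: eq_bigr => S _.
rewrite scaler_sumr -big_split; apply: eq_bigr => T _.
by rewrite !ffunE lie_linearr tens_linearr.
Qed.

Lemma schouten_lower_central a b u v :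
  (forall S, u S \in lower_central L a) -> (forall S, v S \in lower_central L b) ->
  forall S, schouten L u v S \in lower_central L (a + b).+1.
Proof.
move=> ua vb U; rewrite sum_ffunE memv_suml // => S _.
rewrite sum_ffunE memv_suml // => T _.
by rewrite ffunE; apply/memvZ/memv_lie_lower_central.
Qed.

Lemma Phi_lower_central mu k S : Phi_ L e mu k.+1 S \in lower_central L k.
Proof.
have [A A_lin AE] := delta_proj_exact_opg L e.
elim/ltn_ind: k S => -[_ S|k IHk S]; first exact: memvf.
rewrite Phi_rec // AE ffunE memvN; apply: opg_coef => {}S.
rewrite sum_ffunE big_nat memv_suml // => -[//|i] /andP[_ ik].
rewrite subSS subSn //.
(* The summand is [Phi_(i+1), Phi_(k-i+1)], with coefficients in C_i and C_(k-i) before the bracket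
   adds one. *)
have -> : k.+1 = (i + (k - i)).+1 by rewrite subnKC.
by apply: schouten_lower_central => T; apply: IHk; rewrite ?ltnS ?leq_subr.
Qed.

Variable nu : nat.
Hypothesis nu0 : lower_central L nu = 0%VS.

Lemma Phi_eq0 mu k : (nu < k)%N -> Phi_ L e mu k = 0.
Proof.
case: k => // k nuk; apply/ffunP => S; rewrite ffunE; apply/eqP.
by rewrite -memv0 -(lower_central_eq0 nu0 nuk); exact: Phi_lower_central.
Qed.

(** The partial sums are eventually constant, which gives both the convergence of the series and its
    value. *)
Lemma Phi_sum_stable mu S N : (nu < N)%N ->
  \sum_(1 <= k < N) Phi_ L e mu k S = \sum_(1 <= k < nu.+1) Phi_ L e mu k S.
Proof.
move=> nuN; rewrite (big_cat_nat (n := nu.+1)) //=.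
rewrite [X in _ + X]big_nat [X in _ + X]big1 ?addr0 // => k /andP[nuk _].
by rewrite Phi_eq0 // ffunE.
Qed.

Lemma Phi_cvgP mu : Phi_cvg L e mu.
Proof.
move=> S; apply: (is_cvg_near_cst (\sum_(1 <= k < nu.+1) Phi_ L e mu k S)).
by near=> N; apply: Phi_sum_stable; near: N; exact: nbhs_infty_gt.
Unshelve. all: by end_near. Qed.

Lemma Phi_finite_sum mu : Phi L e mu = \sum_(1 <= k < nu.+1) Phi_ L e mu k.
Proof.
apply/ffunP => S; rewrite ffunE sum_ffunE; apply: norm_lim_near_cst.
by near=> N; apply: Phi_sum_stable; near: N; exact: nbhs_infty_gt.
Unshelve. all: by end_near. Qed.

Lemma schouten_Phi_eq0 mu i j : (0 < i)%N -> (0 < j)%N -> (nu < i + j)%N ->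
  schouten L (Phi_ L e mu i) (Phi_ L e mu j) = 0.
Proof.
case: i j => // i [//|j] _ _; rewrite addSn addnS ltnS => nuij.
apply/ffunP => S; rewrite ffunE; apply/eqP.
rewrite -memv0 -(lower_central_eq0 nu0 nuij).
by apply: schouten_lower_central => T; exact: Phi_lower_central.
Qed.

Lemma obs_finite_sum mu : obs L e mu =
  \sum_(1 <= i < nu) \sum_(1 <= j < nu | (i + j <= nu)%N)
    proj_harmonic L e (schouten L (Phi_ L e mu i) (Phi_ L e mu j)).
Proof.
have [A A_lin AE] := proj_harmonic_opg L e.
have H_lin : linear (proj_harmonic L e) by move=> z u v; rewrite !AE opg_linear.
pose G i j := proj_harmonic L e (schouten L (Phi_ L e mu i) (Phi_ L e mu j)).
have G0 i j : (0 < i)%N -> (0 < j)%N -> (nu < i + j)%N -> G i j = 0.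
  by move=> i0 j0 ij; rewrite /G schouten_Phi_eq0 // (is_linear0 H_lin).
(* Phi has terms up to index nu, whereas the formula stops at nu - 1: the last index drops out, as
   its partner is at least 1. For nu = 0 both ranges are empty. *)
have trim (F : nat -> extg R n) : ((0 < nu)%N -> F nu = 0) ->
    \sum_(1 <= i < nu.+1) F i = \sum_(1 <= i < nu) F i.
  case: (nu) => [_|d F0]; first by rewrite !big_geq.
  by rewrite big_nat_recr //= F0 ?addr0.
rewrite /obs Phi_finite_sum (is_linear_sum _ _ _ (schouten_linearl _)) /=.
rewrite (is_linear_sum _ _ _ H_lin).
transitivity (\sum_(1 <= i < nu.+1) \sum_(1 <= j < nu.+1) G i j).
  apply: eq_bigr => i _; rewrite (is_linear_sum _ _ _ (schouten_linearr _)).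
  by rewrite (is_linear_sum _ _ _ H_lin).
rewrite trim => [|nu_gt0]; last first.
  by rewrite big_nat big1 // => j /andP[j0 _]; rewrite G0 // -addn1 leq_add2l.
apply: eq_big_nat => i /andP[i0 _].
rewrite trim => [|nu_gt0]; last by rewrite G0 // -add1n leq_add2r.
rewrite [RHS]big_mkcond; apply: eq_big_nat => j /andP[j0 _].
by case: leqP => // /(G0 i j i0 j0).
Qed.

End Obstruction.

(** * Degree bounds for polynomial functions of the coordinates *)

Section PolynomialFunctions.
Import (canonicals) mpoly.
Variables (R : realType) (m n : nat).
Local Notation C := (R[i])^o.
Implicit Types (f g : 'M[R[i]]_(m, n) -> C) (F : mpoly.mpoly (m * n) R[i]).
Implicit Types (u v : 'M[R[i]]_(m, n) -> extg R n).

Definition is_poly_le d f := exists2 F, degree_le F d & forall t, f t = poly_fun F t.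

Lemma degree_leP F d :
  degree_le F d <-> {in mpoly.msupp F, forall p, (mpoly.mdeg p <= d)%N}.
Proof. by split=> Fd p; have := Fd p; rewrite mpoly.mcoeff_msupp. Qed.

Lemma eq_is_poly_le d f g : f =1 g -> is_poly_le d f -> is_poly_le d g.
Proof. by move=> fg [F Fd fE]; exists F => // t; rewrite -fg. Qed.

Lemma is_poly_leW d d' f : (d <= d')%N -> is_poly_le d f -> is_poly_le d' f.
Proof.
by move=> dd' [F Fd fE]; exists F => // p /Fd /leq_trans; exact.
Qed.

Lemma is_poly_le0 d : is_poly_le d (fun=> 0).
Proof.
exists 0 => [|t]; first by apply/degree_leP => p; rewrite mpoly.msupp0.
by rewrite /poly_fun mpoly.meval0.
Qed.

Lemma is_poly_leD d f g :
  is_poly_le d f -> is_poly_le d g -> is_poly_le d (fun t => f t + g t).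
Proof.
move=> [F /degree_leP Fd fE] [G /degree_leP Gd gE].
exists (F + G) => [|t]; last by rewrite fE gE /poly_fun mpoly.mevalD.
apply/degree_leP => p /mpoly.msuppD_le; rewrite mem_cat.
by case/orP => [/Fd|/Gd].
Qed.

Lemma is_poly_leZ d (z : R[i]) f : is_poly_le d f -> is_poly_le d (fun t => z * f t).
Proof.
move=> [F /degree_leP Fd fE].
exists (z *: F) => [|t]; last by rewrite fE /poly_fun mpoly.mevalZ.
by apply/degree_leP => p /mpoly.msuppZ_le /Fd.
Qed.

Lemma is_poly_leM d d' f g :
  is_poly_le d f -> is_poly_le d' g -> is_poly_le (d + d') (fun t => (f t : R[i]) * g t).
Proof.
move=> [F /degree_leP Fd fE] [G /degree_leP Gd gE].
exists (F * G) => [|t]; last by rewrite fE gE /poly_fun mpoly.mevalM.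
apply/degree_leP => p /mpoly.msuppM_le /allpairsP[[q r] /= [/Fd qd /Gd rd ->]].
by rewrite mpoly.mdegD leq_add.
Qed.

Lemma is_poly_le_sum d (I : Type) (s : seq I) (P : pred I) (f : I -> 'M[R[i]]_(m, n) -> C) :
  (forall i, P i -> is_poly_le d (f i)) ->
  is_poly_le d (fun t => \sum_(i <- s | P i) f i t).
Proof.
move=> fd; elim: s => [|i s IHs].
  by apply: eq_is_poly_le (is_poly_le0 d) => t; rewrite big_nil.
have [Pi|nPi] := boolP (P i).
  by apply: eq_is_poly_le (is_poly_leD (fd i Pi) IHs) => t; rewrite big_cons Pi.
by apply: eq_is_poly_le IHs => t; rewrite big_cons (negbTE nPi).
Qed.

Lemma is_poly_le_entry i j : is_poly_le 1 (fun t => t i j).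
Proof.
exists (mpoly.mpolyX R[i] (mpoly.mnm1 (mxvec_index i j))) => [|t].
  by apply/degree_leP => p; rewrite mpoly.msuppX inE => /eqP->; rewrite mpoly.mdeg1.
by rewrite /poly_fun mpoly.mevalXU mxvecE.
Qed.

Definition is_polyg_le d u := forall S k, is_poly_le d (fun t => u t S 0 k).

Lemma eq_is_polyg_le d u v : u =1 v -> is_polyg_le d u -> is_polyg_le d v.
Proof. by move=> uv ud S k; apply: eq_is_poly_le (ud S k) => t; rewrite uv. Qed.

(** In the basis [B S k] of the tensor product, a linear form is a combination of the coordinates of
    [u t] with constant coefficients, so no degree is gained. *)
Lemma is_poly_le_linear d u (l : extg R n -> C) :
  linear l -> is_polyg_le d u -> is_poly_le d (fun t => l (u t)).
Proof.
move=> l_lin ud; pose B S k : extg R n := tens (mono R S) (delta_mx 0 k).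
apply: (@eq_is_poly_le d (fun t => \sum_S \sum_k (l (B S k) : R[i]) * (u t S 0 k))).
  move=> t; have utE : u t = \sum_S \sum_k u t S 0 k *: B S k.
    apply/ffunP => T; apply/rowP => j; rewrite sum_ffunE summxE (bigD1 T) //=.
    rewrite sum_ffunE summxE (bigD1 j) //= !ffunE !mxE !eqxx !mulr1.
    rewrite !big1 ?addr0 // => [S ST|k kj].
      rewrite sum_ffunE summxE big1 // => k _.
      by rewrite !ffunE !mxE eq_sym (negbTE ST) mul0r mulr0.
    by rewrite !ffunE !mxE !eqxx eq_sym (negbTE kj) !mulr0.
  rewrite [in RHS]utE (is_linear_sum _ _ _ l_lin); apply: eq_bigr => S _.
  rewrite (is_linear_sum _ _ _ l_lin); apply: eq_bigr => k _.
  by rewrite (is_linearZ _ l_lin); exact: mulrC.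
by apply: is_poly_le_sum => S _; apply: is_poly_le_sum => k _; exact: is_poly_leZ.
Qed.

Lemma is_polyg_le_linear d u (A : extg R n -> extg R n) :
  linear A -> is_polyg_le d u -> is_polyg_le d (fun t => A (u t)).
Proof.
move=> A_lin ud S k; apply: (is_poly_le_linear (l := fun x => A x S 0 k)) => //.
by move=> z x y; rewrite A_lin !ffunE !mxE.
Qed.

Lemma is_polyg_le_sum d (I : Type) (s : seq I) (P : pred I)
    (u : I -> 'M[R[i]]_(m, n) -> extg R n) :
  (forall i, P i -> is_polyg_le d (u i)) ->
  is_polyg_le d (fun t => \sum_(i <- s | P i) u i t).
Proof.
move=> ud S k; apply: (@eq_is_poly_le d (fun t => \sum_(i <- s | P i) u i t S 0 k)).
  by move=> t; rewrite sum_ffunE summxE.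
by apply: is_poly_le_sum => i Pi; exact: ud.
Qed.

Variable L : lie_algebra R n.

Lemma lie_coord_sum (x y : 'rV[R[i]]_n) :
  L x y = \sum_i \sum_j (x 0 i * y 0 j) *: L (delta_mx 0 i) (delta_mx 0 j).
Proof.
rewrite {1}(row_sum_delta x) (is_linear_sum _ _ _ (lie_linearl L y)) /=.
apply: eq_bigr => i _; rewrite (is_linearZ _ (lie_linearl L y)) /=.
rewrite {1}(row_sum_delta y) (is_linear_sum _ _ _ (lie_linearr L _)) scaler_sumr.
by apply: eq_bigr => j _; rewrite (is_linearZ _ (lie_linearr L _)) scalerA.
Qed.

(** Expanded by structure constants, each coordinate is a constant combination of products of one
    coordinate of u and one of v, so degrees add. *)
Lemma is_polyg_le_schouten d d' u v : is_polyg_le d u -> is_polyg_le d' v ->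
  is_polyg_le (d + d') (fun t => schouten L (u t) (v t)).
Proof.
move=> ud vd; apply: is_polyg_le_sum => S _; apply: is_polyg_le_sum => T _ U k.
pose c := wedge (mono R S) (mono R T) U.
apply: (@eq_is_poly_le _ (fun t => (c : R[i]) *
    \sum_i \sum_j (L (delta_mx 0 i) (delta_mx 0 j) 0 k : R[i]) * (u t S 0 i * v t T 0 j))).
  move=> t; rewrite ffunE mxE (lie_coord_sum (u t S)) summxE; congr (_ * _).
  apply: eq_bigr => i _; rewrite summxE; apply: eq_bigr => j _.
  by rewrite mxE; exact: mulrC.
apply: is_poly_leZ; apply: is_poly_le_sum => i _; apply: is_poly_le_sum => j _.
by apply: is_poly_leZ; apply: is_poly_leM; [exact: ud | exact: vd].
Qed.

Variables (h : hermitian_metric R n) (e : unitary_frame h).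
Variables (w : m.-tuple (ext R n)) (E : n.-tuple 'rV[R[i]]_n).

Lemma is_polyg_le_mu_of : is_polyg_le 1 (mu_of w E).
Proof.
apply: is_polyg_le_sum => i _; apply: is_polyg_le_sum => j _ S k.
apply: (@eq_is_poly_le 1 (fun t => (tens (tnth w i) (tnth E j) S 0 k : R[i]) * t i j)).
  by move=> t; rewrite [in RHS]ffunE [in RHS]mxE; exact: mulrC.
by apply: is_poly_leZ; exact: is_poly_le_entry.
Qed.

Lemma is_polyg_le_Phi k : is_polyg_le k (fun t => Phi_ L e (mu_of w E t) k).
Proof.
have [A A_lin AE] := delta_proj_exact_opg L e.
elim/ltn_ind: k => -[_|[_|k IHk]].
(* Index 0 is the dummy entry of [Phi_seq], which is zero. *)
- move=> S k; apply: (@eq_is_poly_le _ (fun=> 0)); last exact: is_poly_le0.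
  by move=> t; rewrite /Phi_ ffunE mxE.
- exact: is_polyg_le_mu_of.
have opA_lin : linear (fun x => - opg A x).
  by move=> z x y; rewrite opg_linear opprD scalerN.
apply: (@eq_is_polyg_le _ (fun t => - opg A (\sum_(i < k.+1)
    schouten L (Phi_ L e (mu_of w E t) i.+1) (Phi_ L e (mu_of w E t) (k - i).+1)))).
  move=> t; rewrite Phi_rec // AE big_add1 /= big_mkord; congr (- opg A _).
  by apply: eq_bigr => i _; rewrite subSS subSn // -ltnS.
apply: (is_polyg_le_linear opA_lin); apply: is_polyg_le_sum => i _.
(* The indices in each bracket add up to the index of the new term, and so do the degrees. *)
have -> : k.+2 = (i.+1 + (k - i).+1)%N by rewrite addnS addSn subnKC // -ltnS.
by apply: is_polyg_le_schouten; apply: IHk; rewrite !ltnS ?leq_subr ?ltnS // -ltnS.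
Qed.

(** In the finite formula the (i, j) term has degree at most i + j, so the summation condition i + j
    <= nu is itself the degree bound. *)
Lemma is_poly_le_obs nu (nu0 : lower_central L nu = 0%VS) (l : extg R n -> C) :
  linear l -> is_poly_le nu (fun t => l (obs L e (mu_of w E t))).
Proof.
move=> l_lin; have [A A_lin AE] := proj_harmonic_opg L e.
have lA_lin : linear (fun x => l (opg A x)) by move=> z x y; rewrite opg_linear l_lin.
pose Phi_t i t := Phi_ L e (mu_of w E t) i.
apply: (@eq_is_poly_le _ (fun t => \sum_(1 <= i < nu)
    \sum_(1 <= j < nu | (i + j <= nu)%N) l (opg A (schouten L (Phi_t i t) (Phi_t j t))))).
  move=> t; rewrite (obs_finite_sum e nu0) (is_linear_sum _ _ _ l_lin).
  apply: eq_bigr => i _; rewrite (is_linear_sum _ _ _ l_lin).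
  by apply: eq_bigr => j _; rewrite AE.
apply: is_poly_le_sum => i _; apply: is_poly_le_sum => j ij_nu.
apply: is_poly_leW ij_nu _; apply: (is_poly_le_linear lA_lin).
by apply: is_polyg_le_schouten; exact: is_polyg_le_Phi.
Qed.

End PolynomialFunctions.

(** * The obstruction formula and the equations of the Kuranishi space *)

Unset Implicit Arguments.

Theorem theorem4p5 (R : realType) (n : nat) (X : nilmanifold R n) (nu : nat)
    (nu_step : nilpotent_step (nm_lie X) nu)
    (h : hermitian_metric R n) (e : unitary_frame h)
    (E : n.-tuple 'rV[R[i]]_n) (basis_E : basis_of fullv E)
    (m : nat) (w : m.-tuple (ext R n))
    (basis_w : basis_of (hodge_harmonic (nm_lie X) e 1) w) :
  (forall t : 'M[R[i]]_(m, n),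
     let mu := mu_of w E t in
     Phi_cvg (nm_lie X) e mu /\
     obs (nm_lie X) e mu =
       \sum_(1 <= i < nu) \sum_(1 <= j < nu | (i + j <= nu)%N)
         proj_harmonic (nm_lie X) e
           (schouten (nm_lie X) (Phi_ (nm_lie X) e mu i) (Phi_ (nm_lie X) e mu j)))
  /\
  (exists (N : nat) (F : 'I_N -> mpoly.mpoly (m * n) R[i]),
     (forall l, degree_le (F l) nu) /\
     exists2 eps0 : R, 0 < eps0 & forall eps : R, 0 < eps -> eps <= eps0 ->
       Kur (nm_lie X) e w E eps =
       cut_out (mu_ball h w E eps) (fun l => poly_fun (F l))).
Proof.
have nu0 : lower_central (nm_lie X) nu = 0%VS by case: nu_step.
split=> [t mu|]; first by split; [exact: Phi_cvgP nu0 mu | exact: obs_finite_sum].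
have polyE (l : 'I_(\dim (tensg (hodge_harmonic (nm_lie X) e 2)))) :
    exists F, degree_le F nu /\ obs_component w E l =1 poly_fun F.
  have [|F Fnu FE] := @is_poly_le_obs _ m _ _ _ e w E nu nu0
    (coord (vbasis (tensg (hodge_harmonic (nm_lie X) e 2))) l).
    by move=> z x y; exact: linearP.
  by exists F.
have [F FP] := choice polyE.
(* One equation for each coordinate of H^2 (x) g. *)
exists (\dim (tensg (hodge_harmonic (nm_lie X) e 2))).
exists F; split=> [l|]; first by have [] := FP l.
(* The components of obs equal the polynomials on the whole space, so any radius serves as bound,
   and supports and ideals agree at once. *)
exists 1 => // eps _ _; rewrite /Kur; congr cut_out.
by apply/funext => l; apply/funext => t; have [_] := FP l.
Qed.
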